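(* Let $K$ be a compact Hausdorff space with $K^{(\alpha)}\neq\varnothing$ for some $3\leq\alpha<\omega$. Then there is an isometric SPR embedding of $C[1,\omega^\alpha]$ into $C(K)$; that is, there is a linear isometric embedding $T:C[1,\omega^\alpha]\to C(K)$ whose image $T(C[1,\omega^\alpha])$ does stable phase retrieval in $C(K)$.
   Context: Scalars are real. For a compact Hausdorff space $K$, $C(K)$ is the Banach lattice of real continuous functions on $K$ with the sup norm and pointwise order. $K^{(\alpha)}$ is the $\alpha$-th Cantor--Bendixson derivative of $K$ (obtained by iterating $\alpha$ times the operation $S\mapsto S'$, where $S'$ is the set of non-isolated points of $S$). $[1,\omega^\alpha]$ is the set of ordinals $\beta$ with $1\le\beta\le\omega^\alpha$ (ordinal exponentiation) with the order topology, a compact Hausdorff space, and $C[1,\omega^\alpha]$ denotes $C([1,\omega^\alpha])$. A linear subspace $E$ of a Banach lattice $X$ does $C$-stable phase retrieval ($C$-SPR) if $\min_{|\lambda|=1}\|x-\lambda y\|\leq C\,\||x|-|y|\|$ for all $x,y\in E$ (the minimum being over unimodular scalars $\lambda$, i.e. $\lambda=\pm1$); it does stable phase retrieval (SPR) if it does $C$-SPR for some constant $C\geq1$. *)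

(* Defs.v *)
From HB Require Import structures.
From mathcomp Require Import all_boot all_order all_algebra.
From mathcomp Require Import all_classical all_reals all_analysis.

Set Implicit Arguments.
Unset Strict Implicit.
Unset Printing Implicit Defensive.

Import Order.TTheory GRing.Theory Num.Theory.
Import numFieldNormedType.Exports.

Local Open Scope classical_set_scope.
Local Open Scope ring_scope.

Section CantorBendixson.
Context {K : topologicalType}.

Definition derived_set (S : set K) : set K := S `\` isolated S.

(* Only finite orders of derivation are needed. *)
Definition cantor_bendixson (n : nat) : set K := iter n derived_set [set: K].

End CantorBendixson.

Section ContinuousFunctions.
Context {R : realType} {K : topologicalType}.
Local Notation CK := (continuousType K R).
Implicit Types (f g : CK) (a : R).

Let add_continuous f g : continuous (fun x => f x + g x).
Proof. by move=> x; apply: cvgD; exact: cts_fun. Qed.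
Let opp_continuous f : continuous (fun x => - f x).
Proof. by move=> x; apply: cvgN; exact: cts_fun. Qed.
Let scale_continuous a f : continuous (fun x => a * f x).
Proof. by move=> x; apply: cvgMl_tmp; exact: cts_fun. Qed.
Let abs_continuous f : continuous (fun x => `|f x|).
Proof. by move=> x; apply: cvg_norm; exact: cts_fun. Qed.

Let cadd f g : CK := mkcts (@add_continuous f g).
Let copp f : CK := mkcts (@opp_continuous f).
Let cscale a f : CK := mkcts (@scale_continuous a f).

Let caddA : associative cadd.
Proof. by move=> f g h; apply/continuousEP => x; exact: addrA. Qed.
Let caddC : commutative cadd.
Proof. by move=> f g; apply/continuousEP => x; exact: addrC. Qed.
Let cadd0 : left_id (cst 0 : CK) cadd.
Proof. by move=> f; apply/continuousEP => x; exact: add0r. Qed.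
Let caddN : left_inverse (cst 0 : CK) copp cadd.
Proof. by move=> f; apply/continuousEP => x; exact: addNr. Qed.

HB.instance Definition _ :=
  GRing.isZmodule.Build CK caddA caddC cadd0 caddN.

Let cscaleA a b f : cscale a (cscale b f) = cscale (a * b) f.
Proof. by apply/continuousEP => x; exact: mulrA. Qed.
Let cscale1 : left_id 1 cscale.
Proof. by move=> f; apply/continuousEP => x; exact: mul1r. Qed.
Let cscaleDr : right_distributive cscale +%R.
Proof. by move=> a f g; apply/continuousEP => x; exact: mulrDr. Qed.
Let cscaleDl f : {morph cscale^~ f : a b / a + b}.
Proof. by move=> a b; apply/continuousEP => x; exact: mulrDl. Qed.

HB.instance Definition _ :=
  GRing.Zmodule_isLmodule.Build R CK cscaleA cscale1 cscaleDr cscaleDl.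

Lemma ctsD f g x : (f + g) x = f x + g x. Proof. by []. Qed.
Lemma ctsN f x : (- f) x = - f x. Proof. by []. Qed.
Lemma ctsZ a f x : (a *: f) x = a * f x. Proof. by []. Qed.

(* The order of C(K) is pointwise, hence so is the lattice modulus |f|. *)
Definition cabs f : CK := mkcts (@abs_continuous f).

(* K is compact in all uses, so the range of |f| is bounded and [sup] is not *)
(* its junk value.                                                           *)
Definition supnorm f : R := sup (range (fun x => `|f x|)).

(* E is meant to be a linear subspace; the unimodular scalars are 1 and -1. *)
Definition does_CSPR (C : R) (E : set CK) : Prop :=
  forall f g, E f -> E g ->
    Num.min (supnorm (f - g)) (supnorm (f + g))
      <= C * supnorm (cabs f - cabs g).

Definition does_SPR (E : set CK) : Prop :=
  exists2 C : R, 1 <= C & does_CSPR C E.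

End ContinuousFunctions.

(* The ordinals below omega^(n+1), in Cantor normal form: the tuple          *)
(* (a_n, ..., a_0) stands for omega^n * a_n + ... + omega * a_1 + a_0.       *)
(* The lexicographic order compares a_n first, as the ordinal order does.    *)
Definition ordinal_lt_omega_exp (n : nat) := n.+1.-tuplelexi nat.

(* omega^k, for k <= n; entry i is the coefficient of omega^(n - i). *)
Definition omega_exp (n k : nat) : ordinal_lt_omega_exp n :=
  [tuple ((i + k == n)%N : nat) | i < n.+1].

(* The interval [1, omega^n]. *)
Definition ordinal_itv (n : nat) :=
  {b : ordinal_lt_omega_exp n |
    (omega_exp n 0 <= b)%O && (b <= omega_exp n n)%O}.

HB.instance Definition _ (n : nat) := SubChoice.on (ordinal_itv n).
HB.instance Definition _ (n : nat) :=
  [SubChoice_isSubOrder of ordinal_itv n by <: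
     with Order.seqlexi_display Order.NatOrder.nat_display].

Definition ordinal_space (n : nat) := order_topology (ordinal_itv n).

(* Main.v *)
(* The ordinals in [1, w^n] form a tree of height n: the children of a point   *)
(* x of rank k > 0 are the points x_c of rank k - 1 converging to x, and the   *)
(* root is w^n. For f continuous, the differences d_x f = f(x) - f(parent x)   *)
(* (with d_root f = f(w^n)) tend to 0 along any enumeration of the tree, and   *)
(* |f| <= (n + 1) sup_x |d_x f|; so f |-> (d_x f)_x behaves like a             *)
(* c_0-valued embedding.                                                       *)
(* Let p be a point of the n-th derived set of K and q <> p a point of the     *)
(* second one (n >= 3 makes p a limit of such points). Near p, a tree of bump  *)
(* functions e_x gives the isometric embedding f |-> \sum_x (d_x f) e_x. Near  *)
(* q, away from p, a tree of bumps of height 2 makes T f take all the values   *)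
(* (d_x f + d_y f) / 4, which keeps T isometric. If u and v have norm > C S,   *)
(* then d_x u and d_y v are large for some x and y, and at one of the pairs    *)
(* (x, x), (y, y), (x, y) both T u and T v exceed S. With u = f - g and        *)
(* v = f + g this is stable phase retrieval for the range of T, because        *)
(* ||a| - |b|| = min(|a - b|, |a + b|).                                        *)
From HB Require Import structures.
Require Import Defs.
From mathcomp Require Import all_boot all_order all_algebra.
From mathcomp Require Import all_classical all_reals all_analysis.
From mathcomp Require Import ring lra zify.

Set Implicit Arguments.
Unset Strict Implicit.
Unset Printing Implicit Defensive.

Import Order.TTheory GRing.Theory Num.Theory.
Import numFieldNormedType.Exports.
Local Open Scope classical_set_scope.
Local Open Scope ring_scope.

(** Continuity on [1, w^n] enters only as [tree_cts] on nodes, from which [tree_diff_small] extracts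
    the c_0 behaviour of the increments. [bump_tree_exists] turns any such function of nodes into an
    element of C(K) that attains its values down to a given depth and stays in every interval
    containing 0 and those values. The copy of [f] near p gives norm at least that of [f]; the
    disjointly supported copy of [pair_values] near q does not raise it, increments being at most
    twice the norm. [pair_functionals_CSPR] then yields the SPR constant 8(n + 1). *)

(** * Points of [1, w^n] as nodes of a tree *)

Section NodeOrdinals.
Local Open Scope order_scope.
Local Notation lex := (seqlexi nat).

Lemma lexi_consN (x y : nat) (s t : lex) :
  ((x :: s : lex) <= (y :: t : lex)) = (x <= y)%N && ((y <= x)%N ==> (s <= t)).
Proof. exact: lexi_cons. Qed.

Lemma ltxi_consN (x y : nat) (s t : lex) :
  ((x :: s : lex) < (y :: t : lex)) = (x <= y)%N && ((y <= x)%N ==> (s < t)).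
Proof. exact: ltxi_cons. Qed.

(* Nodes of the tree are finite sequences: the c-th child of the node s is     *)
(* rcons s c, and the node [:: c_1; ..; c_j] of [1, w^m] is the ordinal        *)
(* w^(m-1) c_1 + .. + w^(m-j+1) c_(j-1) + w^(m-j) (c_j + 1), whose supremum    *)
(* over c_j is its parent. Here [a] is the pending coefficient of w^m, and     *)
(* the entries of a sequence beyond depth m are ignored.                       *)
Fixpoint node_cnf (m a : nat) (s : seq nat) : lex :=
  if m is m'.+1 then
    if s is c :: s' then a :: node_cnf m' c s' else a.+1 :: nseq m 0%N
  else [:: a.+1].

Lemma size_node_cnf m a s : size (node_cnf m a s) = m.+1.
Proof.
elim: m a s => [//|m IH] a [|c s] /=; first by rewrite size_nseq.
by rewrite IH.
Qed.

Lemma lexi_nseq0 m (z : lex) : size z = m -> (nseq m 0%N : lex) <= z.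
Proof.
elim: m z => [|m IH] [|b z] //= [/IH zm].
by rewrite lexi_consN leq0n /= zm implybT.
Qed.

Lemma lexi_le_nseq0 m (z : lex) :
  size z = m -> (z <= (nseq m 0%N : lex)) = (z == nseq m 0%N).
Proof. by move=> /lexi_nseq0 zm; rewrite eq_le zm andbT. Qed.

Lemma node_cnf_neq0 m a s : node_cnf m a s != nseq m.+1 0%N.
Proof.
elim: m a s => [//|m IH] a [|c s] //=.
by rewrite eqseq_cons negb_and; apply/orP; right; exact: IH.
Qed.

Lemma head_node_cnf m a s : (a <= head 0%N (node_cnf m a s))%N.
Proof. by case: m => [|m] /=; case: s => [|c s] /=. Qed.

Lemma node_cnf_prefix m a s t : node_cnf m a (s ++ t) <= node_cnf m a s.
Proof.
elim: m a s t => [//|m IH] a [|c s] t /=; last by rewrite lexi_consN leqnn IH.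
by case: t => [//|c t]; rewrite lexi_consN leqnSn /= ltnn.
Qed.

(** A smaller leading coefficient settles the comparison; on a tie the argument descends. At the end
    of [s] the node has coefficient a + 1 but its descendants only a, so [c] must exceed the next
    coefficient of [z]. *)
Lemma node_cnf_cvg m a s (z : lex) : size z = m.+1 -> z < node_cnf m a s ->
  exists N, forall c t, (N <= c)%N -> z < node_cnf m a (s ++ c :: t).
Proof.
elim: m a s z => [|m IH] a s [|b z] //= [zm]; first by exists 0%N.
case: s => [|c s].
  rewrite ltxi_consN => /andP[ba1 /implyP bz].
  exists (head 0%N z).+1 => c t Nc /=.
  rewrite ltxi_consN; have ba : (b <= a)%N.
    rewrite leqNgt; apply/negP => ab; move: bz; rewrite ab => /(_ isT).
    by rewrite ltNge (lexi_nseq0 (m := m.+1)).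
  rewrite ba /=; apply/implyP => _.
  case: z zm Nc {bz} => [//|h z] zm Nc.
  have := head_node_cnf m c t.
  case: (node_cnf m c t) (size_node_cnf m c t) => [//|h' t'] _ /= ch.
  have hh : (h < h')%N by rewrite (leq_trans Nc).
  by rewrite ltxi_consN (ltnW hh) /= leqNgt hh.
rewrite ltxi_consN => /andP[ba /implyP bz].
have [ab|nab] := boolP (a <= b)%N.
  have [N HN] := IH _ _ _ zm (bz ab).
  by exists N => c' t' Nc'; rewrite /= ltxi_consN ba HN // implybT.
by exists 0%N => c' t' _; rewrite /= ltxi_consN ba (negbTE nab).
Qed.

(** The sequence [a :: s] lists the coefficients of [z] up to the last nonzero one, the latter
    lowered by 1. *)
Lemma node_cnf_surj m (z : lex) : size z = m.+1 -> z != nseq m.+1 0%N ->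
  exists a s, z = node_cnf m a s.
Proof.
elim: m z => [|m IH] [|b z] //= [zm].
  move: zm => /size0nil ->; case: b => [//|b] _.
  by exists b, [::].
have [z0|zn0] := eqVneq z (nseq m.+1 0%N).
  rewrite z0; case: b => [|b] /=; first by rewrite eqxx.
  by move=> _; exists b, [::].
move=> _; have [a [s ->]] := IH _ zm zn0.
by exists b, (a :: s).
Qed.

Lemma node_cnf_head0 m a s :
  node_cnf m a s <= node_cnf m 0 [::] -> a = 0%N.
Proof.
case: m => [|m] /=; first by rewrite lexi_consN; case: a.
case: s => [|c s] /=; rewrite lexi_consN; first by case: a.
case: a => [//|[|//]] /= H; exfalso; move: H.
rewrite (lexi_le_nseq0 (m := m.+1)) ?size_node_cnf //.
by apply/negP; exact: node_cnf_neq0.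
Qed.

Lemma omega_exp_top n : omega_exp n n = node_cnf n 0 [::] :> seq nat.
Proof.
apply: (@eq_from_nth _ 0%N); first by rewrite size_tuple size_node_cnf.
rewrite size_tuple => i ltin.
rewrite -(tnth_nth 0%N _ (Ordinal ltin)) tnth_mktuple /=.
case: n i ltin => [|n] [|i] //= ltin; first by rewrite eqxx.
by rewrite (nth_nseq 0%N n.+1) if_same; case: eqP => //; lia.
Qed.

Lemma omega_exp_bottom_le n (z : lex) :
  size z = n.+1 -> z != nseq n.+1 0%N -> (omega_exp n 0 : lex) <= z.
Proof.
suff -> : (omega_exp n 0 : lex) = rcons (nseq n 0%N) 1%N.
  elim: n z => [|n IH] [|b z] //= [zn] zn0; rewrite lexi_consN /=.
    by move: zn zn0 => /size0nil ->; case: b => [|[]].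
  apply/implyP; rewrite leqn0 => /eqP b0; apply: IH => //.
  by move: zn0; rewrite b0; apply: contraNneq => ->.
apply: (@eq_from_nth _ 0%N); first by rewrite size_tuple size_rcons size_nseq.
rewrite size_tuple => i ltin.
rewrite -(tnth_nth 0%N _ (Ordinal ltin)) tnth_mktuple /= addn0.
rewrite nth_rcons size_nseq nth_nseq if_same.
by case: ltngtP => //; lia.
Qed.

Definition node_tuple n s : ordinal_lt_omega_exp n :=
  Tuple (introT eqP (size_node_cnf n 0 s)).

Lemma node_tuple_itv n s :
  (omega_exp n 0 <= node_tuple n s) && (node_tuple n s <= omega_exp n n).
Proof.
apply/andP; split.
  by apply: omega_exp_bottom_le; [exact: size_node_cnf|exact: node_cnf_neq0].
change ((node_cnf n 0 s : lex) <= (omega_exp n n : seq nat)).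
by rewrite omega_exp_top; exact: (node_cnf_prefix n 0 [::] s).
Qed.

Definition node_point n s : ordinal_space n :=
  exist _ (node_tuple n s) (node_tuple_itv n s).

Lemma node_point_surj n (x : ordinal_space n) : exists s, x = node_point n s.
Proof.
case: x => z zP; have /andP[z1 z2] := zP.
have z0 : (tval z : lex) != nseq n.+1 0%N.
  apply/eqP => z0; have := z1.
  change ((omega_exp n 0 : lex) <= (tval z : lex) -> False).
  rewrite z0 (lexi_le_nseq0 (m := n.+1)) ?size_tuple // => /eqP e.
  have : tnth (omega_exp n 0) ord_max = 0%N.
    by rewrite (tnth_nth 0%N) e nth_nseq if_same.
  by rewrite tnth_mktuple /= addn0 eqxx.
have [a [s zE]] := @node_cnf_surj n z (size_tuple z) z0.
have a0 : a = 0%N.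
  apply: (@node_cnf_head0 n a s); rewrite -zE -omega_exp_top; exact: z2.
by exists s; do 2 apply: val_inj; rewrite [LHS]zE a0.
Qed.

(** Descendants lie below their ancestor, so only the left end of a basic interval constrains them,
    and [node_cnf_cvg] deals with it. *)
Lemma node_point_nbhs n s (A : set (ordinal_space n)) : nbhs (node_point n s) A ->
  exists N, forall c t, (N <= c)%N -> A (node_point n (s ++ c :: t)).
Proof.
rewrite order_nbhs_itv => -[[l r] [oi +] iA].
rewrite itv_boundlr => /andP[lx xr].
have le_s t : node_point n (s ++ t) <= node_point n s by exact: node_cnf_prefix.
have [N HN] : exists N, forall c t, (N <= c)%N ->
    l <= BLeft (node_point n (s ++ c :: t)).
  case: l oi {iA} lx => [[] l|[]] oi lx.
  - by case: oi; case: (r) => [[]|[]].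
  - have [N HN] : exists N, forall c t, (N <= c)%N ->
        tval (val l) < node_cnf n 0 (s ++ c :: t) :> lex.
      by apply: node_cnf_cvg; [exact: size_tuple|exact: lx].
    by exists N => c t /HN; apply.
  - by exists 0%N.
  - by [].
exists N => c t /HN lc; apply: iA; rewrite /= itv_boundlr lc /=.
by apply: le_trans xr; exact: le_s.
Qed.
End NodeOrdinals.

(** * Increments of functions on the tree *)

Section TreeFunctions.
Context {R : realType}.
Implicit Types (a : seq nat -> R) (s t : seq nat) (d : nat -> R) (e : R).

Definition tree_cts a := forall s e, 0 < e ->
  exists N, forall c t, (N <= c)%N -> `|a (s ++ c :: t) - a s| <= e.

Lemma tree_cts_cons a c : tree_cts a -> tree_cts (fun s => a (c :: s)).
Proof. by move=> acts s; exact: (acts (c :: s)). Qed.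

Lemma tree_ctsB a (x : R) : tree_cts a -> tree_cts (fun s => a s - x).
Proof.
move=> acts s e /(acts s)[N HN]; exists N => c t /(HN _ t).
by rewrite opprB addrA subrK.
Qed.

Definition tree_diff a s := if s is c :: s' then a s - a (belast c s') else a s.

Lemma tree_diff_rcons a s c : tree_diff a (rcons s c) = a (rcons s c) - a s.
Proof. by case: s => [//|x s] /=; rewrite belast_rcons. Qed.

Lemma tree_diff_bound a D s :
  (forall s, `|tree_diff a s| <= D) -> `|a s| <= (size s).+1%:R * D.
Proof.
move=> aD; elim/last_ind: s => [|s c IH]; first by rewrite mul1r; exact: (aD [::]).
have -> : a (rcons s c) = tree_diff a (rcons s c) + a s.
  by rewrite tree_diff_rcons subrK.
rewrite (le_trans (ler_normD _ _)) // size_rcons -[X in X%:R]add1n natrD mulrDl.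
by rewrite mul1r lerD.
Qed.

(** In all but finitely many subtrees of the root the values are within e/2 of the root value, so
    increments are at most e; the remaining subtrees have smaller depth. *)
Lemma tree_diff_small m a e :
    tree_cts a -> (forall s, a s = a (take m s)) -> 0 < e ->
  exists L : seq (seq nat), forall s, s \notin L -> `|tree_diff a s| <= e.
Proof.
elim: m a => [|m IH] a acts am e0.
  exists [:: [::]] => -[//|c s] _.
  by rewrite /= am [a (belast _ _)]am !take0 subrr normr0 ltW.
have [N HN] := acts [::] (e / 2) ltac:(by rewrite divr_gt0).
have /choice[L HL] c := IH (fun s => a (c :: s)) (tree_cts_cons c acts)
  (fun s => am (c :: s)) e0.
(* [[:: c]] is listed apart: as root of its subtree its difference there is its value, not the
   increment from the parent. *)
exists ([::] :: flatten [seq [:: c] :: map (cons c) (L c) | c <- iota 0 N]).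
case=> [//|c s]; rewrite inE negb_or /= => sL.
have [Nc|cN] := leqP N c.
  have := HN c s Nc; case: s {sL} => [|x s] /=; first by move=> /le_trans->//; lra.
  have := HN c (belast x s) Nc; rewrite /= => h1 h2.
  have -> : a [:: c, x & s] - a (c :: belast x s) =
    (a [:: c, x & s] - a [::]) - (a (c :: belast x s) - a [::]) by ring.
  by rewrite (le_trans (ler_normB _ _)) //; lra.
have {sL} : c :: s \notin [:: c] :: map (cons c) (L c).
  apply: contra sL => sL; apply/flattenP; eexists; last exact: sL.
  by apply: map_f; rewrite mem_iota.
rewrite inE negb_or => /andP[]; case: s => [|x s]; first by rewrite eqxx.
move=> _ sL; apply: (HL c (x :: s)); apply: contra sL => /(map_f (cons c)).
by [].
Qed.

Definition null_seq d := forall e, 0 < e ->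
  exists N, forall k, (N <= k)%N -> `|d k| <= e.

Definition tree_diff_seq a k : R :=
  if pickle_inv k is Some s then tree_diff a s else 0.

Lemma tree_diff_seq_pickle a s : tree_diff_seq a (pickle s) = tree_diff a s.
Proof. by rewrite /tree_diff_seq pickleK_inv. Qed.

Lemma tree_diff_seq_null m a :
    tree_cts a -> (forall s, a s = a (take m s)) -> null_seq (tree_diff_seq a).
Proof.
move=> acts am e e0; have [L HL] := tree_diff_small acts am e0.
exists (\max_(s <- L) pickle s).+1%N => k Lk.
rewrite /tree_diff_seq; case E: pickle_inv => [s|]; last by rewrite normr0 ltW.
have ks : pickle s = k by have := @pickle_invK (seq nat) k; rewrite E.
apply: HL; apply/negP => sL; move: Lk; rewrite -ks ltnNge => /negP; apply.
by rewrite (leq_bigmax_seq (F := pickle)).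
Qed.

(* The pairs (j, k) with j <= k are coded by the nodes [:: j; k - j]: with all *)
(* pairs allowed, the values on the subtree above [:: j] would not tend to 0   *)
(* as j grows.                                                                 *)
Definition pair_tree d s : R :=
  match s with
  | [::] => 0
  | [:: j] => d j / 4
  | [:: j, k & _] => (d j + d (j + k)%N) / 4
  end.

(** At the root, a large j makes both d_j and d_(j+k) small; at [[:: j]] only d_(j+k) varies; deeper
    down the function is constant. *)
Lemma pair_tree_cts d : null_seq d -> tree_cts (pair_tree d).
Proof.
move=> d0 s e e0; have [N HN] := d0 e e0.
case: s => [|j [|k s]].
- exists N => c t Nc; have := HN c Nc; rewrite /= subr0.
  case: t => [|k t].
    by rewrite ler_norml => ?; rewrite ler_norml; lra.
  have := HN (c + k)%N ltac:(by rewrite (leq_trans Nc) ?leq_addr).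
  by rewrite !ler_norml; lra.
- exists N => c t Nc /=.
  have := HN (j + c)%N ltac:(by rewrite (leq_trans Nc) ?leq_addl).
  by rewrite !ler_norml; lra.
- by exists 0%N => c t _ /=; rewrite subrr normr0 ltW.
Qed.

End TreeFunctions.

(** * Trees of bump functions in a compact Hausdorff space *)

Section BumpTrees.
Context {R : realType} {K : topologicalType}.
Hypothesis (cptK : compact [set: K]) (hausK : hausdorff_space K).
Implicit Types (p : K) (U V W S : set K).

Lemma bump_exists p U : open U -> U p -> exists e : K -> R,
  [/\ continuous e, (forall t, 0 <= e t <= 1), (forall t, ~ U t -> e t = 0),
      e p = 1 & exists W, [/\ open W, W p, W `<=` U & forall t, W t -> e t = 1]].
Proof.
move=> oU Up.
have sep : uniform_separator (~` U) [set p].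
  apply: normal_uniform_separator.
  - exact: compact_normal.
  - exact: open_closedC.
  - exact/accessible_closed_set1/hausdorff_accessible.
  - by apply/seteqP; split => // x [/= nU xp]; apply: nU; rewrite xp.
have [g [gcts g01 g0 g1]] := (uniform_separatorP (R := R) _ _).1 sep.
have gp : g p = 1 by apply: g1; exists p.
have gU t : ~ U t -> g t = 0 by move=> nU; apply: g0; exists t.
have /= grange t : 0 <= g t <= 1.
  by have /= := g01 (g t) ltac:(by exists t); rewrite in_itv.
(* Doubling and truncating the Urysohn function makes it 1 on a whole neighbourhood of [p], which
   leaves room for the bumps of the children. *)
exists (fun t => Num.min 1 (2 * g t)); split.
- move=> t; apply: (@continuous_min R K (fun=> 1) (fun t => 2 * g t)).
    exact: cvg_cst.
  by apply: cvgMl_tmp; exact: gcts.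
- move=> t; have := grange t; rewrite ge_min lexx /= le_min ler01 andbT.
  by case/andP => + _; rewrite /=; lra.
- by move=> t /gU->; rewrite mulr0 min_r.
- by rewrite gp min_l; lra.
exists (g @^-1` [set x | 2^-1 < x]); split.
- by apply: open_comp => //; exact: open_gt.
- by rewrite /= gp; lra.
- by move=> t /=; apply: contraPP => /gU->; apply/negP; rewrite -leNgt; lra.
- by move=> t /= gt; rewrite min_l //; lra.
Qed.

(** Repeatedly separate [p] from another point of [S] in the current neighbourhood of [p], then
    shrink that neighbourhood; later sets avoid all earlier ones. *)
Lemma derived_set_seq S p W : derived_set S p -> open W -> W p ->
  exists (q : nat -> K) (U : nat -> set K),
  [/\ forall k, S (q k), forall k, open (U k), forall k, U k (q k),
      forall k, U k `<=` W & (forall k, ~ U k p) /\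
      forall j k t, U j t -> U k t -> j = k].
Proof.
move=> [Sp isop] oW Wp.
(* [r] packs the new point, its neighbourhood and the next neighbourhood of [p]; the premises on [V]
   stay under the existential so that [choice] applies to all sets. *)
have step V : exists r : K * set K * set K, open V -> V p ->
    [/\ S r.1.1, open r.1.2, r.1.2 r.1.1 & r.1.2 `<=` V] /\
    [/\ open r.2, r.2 p, r.2 `<=` V & r.1.2 `&` r.2 = set0].
  have [[oV Vp]|nV] := pselect (open V /\ V p); last first.
    by exists (p, set0, set0) => oV Vp; exfalso; apply: nV.
  have [q [Vq Sq qp]] : exists q, [/\ V q, S q & q <> p].
    apply: contrapT => nq; apply: isop; split; first exact/mem_set.
    exists V; first exact: open_nbhs_nbhs.
    apply/seteqP; split => [x [Vx Sx]|x ->]; last by split.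
    by apply: contrapT => xp; apply: nq; exists x.
  have := hausK; rewrite open_hausdorff => /(_ q p ltac:(exact/eqP)).
  case=> -[A B] /= [/set_mem Aq /set_mem Bp] [oA oB /eqP AB].
  exists (q, A `&` V, B `&` V) => _ _ /=; split; split => //.
  - exact: openI.
  - exact: openI.
  - by rewrite setIACA AB set0I.
have {step} /choice[r r_step] := step.
pose V k := iter k (fun V => (r V).2) W.
have VP k : open (V k) /\ V k p.
  elim: k => [//|k [oV Vp]]; rewrite /V iterS -/(V k).
  by have [_ []] := r_step _ oV Vp.
have V_decr j k : (j <= k)%N -> V k `<=` V j.
  move=> /subnK <-; elim: (k - j)%N => [//|i IH].
  apply: subset_trans IH; rewrite addSn /V iterS -/(V _).
  by have [oV Vp] := VP (i + j)%N; have [_ []] := r_step _ oV Vp.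
exists (fun k => (r (V k)).1.1), (fun k => (r (V k)).1.2).
have P k := let: conj oV Vp := VP k in r_step _ oV Vp.
split; try by move=> k; have [[]] := P k.
  by move=> k; have [[_ _ _ UV] _] := P k; exact: subset_trans UV (V_decr 0%N k _).
have UV j k t : (j < k)%N -> V k t -> ~ (r (V j)).1.2 t.
  move=> jk /(V_decr _ _ jk) Vt Ut; have [_ [_ _ _]] := P j.
  by move=> AB; have [] : (set0 : set K) t by rewrite -AB.
split=> [k|j k t Uj Uk]; first by apply: (UV _ k.+1) => //; have [] := VP k.+1.
have Vj : V j t by have [[_ _ _ UVj] _] := P j; exact: UVj.
have Vk : V k t by have [[_ _ _ UVk] _] := P k; exact: UVk.
by case: (ltngtP j k) => // jk; exfalso; [apply: UV jk Vk Uj|apply: UV jk Vj Uk].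
Qed.

Lemma uniform_approx_continuous (F : K -> R) :
  (forall e, 0 < e ->
    exists2 g : K -> R, continuous g & forall t, `|F t - g t| <= e) ->
  continuous F.
Proof.
move=> H t; apply/cvgrPdist_le => /= e e0.
have [g gcts Fg] := H (e / 3) ltac:(by rewrite divr_gt0).
have := gcts t; move/cvgrPdist_le => /(_ (e / 3) ltac:(by rewrite divr_gt0)).
apply: filterS => x gx.
have -> : F t - F x = (F t - g t) + (g t - g x) - (F x - g x) by ring.
have := Fg t; have := Fg x; move: gx; rewrite !ler_norml; lra.
Qed.

(** The range is controlled by an interval around 0, not by a norm, because the induction shifts the
    values by the root value and must lose nothing. *)
Record bump_tree (m : nat) U (Phi : (seq nat -> R) -> K -> R)
    (q : seq nat -> K) : Prop := BumpTree {
  bump_tree_cts : forall a, tree_cts a -> continuous (Phi a);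
  bump_tree_linear : forall k a b t,
    Phi (fun s => k * a s + b s) t = k * Phi a t + Phi b t;
  bump_tree_support : forall a t, ~ U t -> Phi a t = 0;
  bump_tree_range : forall a lo hi t, lo <= 0 -> 0 <= hi ->
    (forall s, lo <= a s <= hi) -> lo <= Phi a t <= hi;
  bump_tree_eval : forall a s, (size s <= m)%N -> Phi a (q s) = a s }.

Lemma bump_tree_point m U Phi q s :
  bump_tree m U Phi q -> (size s <= m)%N -> U (q s).
Proof.
move=> T sm; apply: contrapT => /(bump_tree_support T (fun=> 1)).
by rewrite (bump_tree_eval T) //; apply/eqP; rewrite oner_eq0.
Qed.

(* The nodes of the tree carry bump functions [e_s], the bumps of the children *)
(* of [s] being disjointly supported in the region where [e_s = 1]; then       *)
(* [Phi a = a_root e_root + \sum_(s <> root) (a_s - a_(parent s)) e_s].        *)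
Lemma bump_tree_exists m p U : @cantor_bendixson K m p -> open U -> U p ->
  exists Phi q, bump_tree m U Phi q.
Proof.
elim: m p U => [|m IH] p U pm oU Up.
  have [e [ects e01 eU ep _]] := bump_exists oU Up.
  exists (fun a t => a [::] * e t), (fun=> p); split.
  - by move=> a _ t; apply: cvgMl_tmp; exact: ects.
  - by move=> k a b t; ring.
  - by move=> a t /eU->; rewrite mulr0.
  - move=> a lo hi t lo0 hi0 /(_ [::]); have := e01 t; nra.
  - by move=> a [|//] _; rewrite ep mulr1.
have [e [ects e01 eU ep [W [oW Wp WU eW]]]] := bump_exists oU Up.
have [q [V [qm oV Vq VW [Vp Vdisj]]]] := derived_set_seq pm oW Wp.
have /choice[Phi /choice[r T]] c := IH (q c) (V c) (qm c) (oV c) (Vq c).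
(* At most one child region contains [t]; outside all of them any index will do, every [Phi c] being
   0 there. *)
have /choice[i iP] t : exists c, forall c', V c' t -> c = c'.
  have [[c Vc]|nV] := pselect (exists c, V c t).
    by exists c => c'; exact: Vdisj.
  by exists 0%N => c' Vc'; exfalso; apply: nV; exists c'.
pose b a (c : nat) s : R := a (c :: s) - a [::].
pose F a t := Phi (i t) (b a (i t)) t.
exists (fun a t => a [::] * e t + F a t),
  (fun s => if s is c :: s' then r c s' else p).
split.
- move=> a acts t; apply: cvgD; first by apply: cvgMl_tmp; exact: ects.
  (* Late subtrees contribute at most [d] by the range bound, so finite sums over the children
     approximate uniformly. *)
  apply: uniform_approx_continuous => {t} d d0.
  have [N HN] := acts [::] d d0.
  exists (fun t => \sum_(c < N) Phi c (b a c) t).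
    apply: continuous_big => [|c _]; first exact: add_continuous.
    exact/(bump_tree_cts (T c))/tree_ctsB/tree_cts_cons.
  move=> t; have off c : c <> i t -> Phi c (b a c) t = 0.
    by move=> ci; apply: (bump_tree_support (T c)) => /iP ic; apply: ci.
  have [iN|Ni] := ltnP (i t) N.
    rewrite (bigD1 (Ordinal iN)) //= big1 ?addr0 ?subrr ?normr0 ?ltW //.
    by move=> c /eqP ci; apply: off => ic; apply: ci; apply: val_inj.
  rewrite big1 => [|c _]; last first.
    by apply: off => ic; move: Ni; rewrite -ic leqNgt ltn_ord.
  rewrite subr0 ler_norml; apply: (bump_tree_range (T _)); [lra|lra|].
  by move=> s; rewrite -ler_norml; exact: HN.
- move=> k a a' t; rewrite /F.
  have -> : b (fun s => k * a s + a' s) (i t) =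
      fun s => k * b a (i t) s + b a' (i t) s.
    by apply/funext => s; rewrite /b; ring.
  by rewrite (bump_tree_linear (T _)); ring.
- move=> a t nU; rewrite eU // mulr0 add0r /F (bump_tree_support (T _)) // => Vt.
  exact/nU/WU/VW/Vt.
- move=> a lo hi t lo0 hi0 aP; have a0 := aP [::].
  (* In a child region [e] is 1 and the shift by the root value cancels; elsewhere only the root
     value times [e] remains. *)
  have [Vt|nV] := pselect (V (i t) t).
    rewrite eW; last exact: VW Vt.
    have : lo - a [::] <= F a t <= hi - a [::].
      apply: (bump_tree_range (T _)); [lra|lra|move=> s].
      by have := aP (i t :: s); rewrite /b; lra.
    by lra.
  rewrite /F (bump_tree_support (T _)) // addr0.
  by have := e01 t; nra.
- move=> a [|c s] sm.
    rewrite ep mulr1 /F (bump_tree_support (T _)) ?addr0 //; exact: Vp.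
  have Vr : V c (r c s) := bump_tree_point (T c) sm.
  rewrite /F (iP _ _ Vr) (bump_tree_eval (T c)) // eW; last exact: VW Vr.
  by rewrite /b mulr1; ring.
Qed.

End BumpTrees.

(** * Sup norm and moduli *)

Section SupNorm.
Context {R : realType} {K : topologicalType}.
Implicit Types (f g : continuousType K R).

Lemma supnorm_ub f M t : (forall x, `|f x| <= M) -> `|f t| <= supnorm f.
Proof.
move=> fM; apply: ub_le_sup; last by exists t.
by exists M => _ [x _ <-].
Qed.

Lemma supnorm_le f M (t : K) : (forall x, `|f x| <= M) -> supnorm f <= M.
Proof.
move=> fM; apply: ge_sup; first by exists `|f t|, t.
by move=> _ [x _ <-].
Qed.

End SupNorm.

Lemma dist_norm_gt {R : realDomainType} (x y S : R) :
  S < `|x - y| -> S < `|x + y| -> S < `| `|x| - `|y| |.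
Proof.
have [x0|/ltW x0] := leP 0 x; have [y0|/ltW y0] := leP 0 y => h1 h2.
- by rewrite (ger0_norm x0) (ger0_norm y0).
- by rewrite (ger0_norm x0) (ler0_norm y0) opprK.
- by rewrite (ler0_norm x0) (ger0_norm y0) -opprD normrN.
- by rewrite (ler0_norm x0) (ler0_norm y0) -opprD normrN.
Qed.

(** * Stable phase retrieval from pairs of functionals *)

Section StablePhaseRetrieval.
Context {R : realType} {X K : topologicalType}.
Variables (T : {linear continuousType X R -> continuousType K R}).
Variables (I : Type) (delta : I -> continuousType X R -> R) (B : R).
Hypotheses (Tbnd : forall f, exists M, forall t, `|T f t| <= M)
  (Tisom : forall f, supnorm (T f) = supnorm f)
  (delta_norming : forall f D, (forall i, `|delta i f| <= D) -> supnorm f <= B * D)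
  (delta_pair : forall i j, exists t, forall f, T f t = (delta i f + delta j f) / 4).

(** With u = f - g and v = f + g, no point has both |T u| and |T v| above S. If |d_i u| and |d_j v|
    exceed 8S, the pairs (i, i) and (j, j) force |d_i v| and |d_j u| below 2S or equal to it; at (i,
    j) both values then exceed (8S - 2S) / 4, hence S. *)
Lemma pair_functionals_CSPR : does_CSPR (8 * B) (range T).
Proof.
move=> _ _ [f _ <-] [g _ <-]; set S := supnorm (cabs _ - _).
rewrite -linearB -linearD !Tisom leNgt lt_min; apply/negP => /andP[].
have TS t : `|T (f - g) t| <= S \/ `|T (f + g) t| <= S.
  have [|h1] := leP `|T (f - g) t| S; first by left.
  have [|h2] := leP `|T (f + g) t| S; first by right.
  have [M fM] := Tbnd f; have [N gN] := Tbnd g.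
  have : `|(cabs (T f) - cabs (T g)) t| <= S.
    apply: (supnorm_ub (M := M + N)) => x.
    rewrite (le_trans (ler_normB _ _)) //= !normr_id.
    by apply: lerD; [exact: fM|exact: gN].
  rewrite leNgt => /negP[]; apply: dist_norm_gt.
    by move: h1; rewrite linearB.
  by move: h2; rewrite linearD.
have pick h : 8 * B * S < supnorm h -> exists i, 8 * S < `|delta i h|.
  move=> hS; apply: contrapT => nd; move: hS; apply/negP; rewrite -leNgt.
  rewrite mulrAC mulrC; apply: delta_norming => i; rewrite leNgt.
  by apply/negP => di; apply: nd; exists i.
move=> /pick[i di] /pick[j dj].
have [t Tt] := delta_pair i j; have [ti Tti] := delta_pair i i.
have [tj Ttj] := delta_pair j j.
move: (TS t) (TS ti) (TS tj); rewrite !Tt !Tti !Ttj.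
have norm4 (x : R) : `|x / 4| = `|x| / 4 by rewrite normrM [`|_^-1|]ger0_norm.
have normDD (x : R) : `|x + x| = 2 * `|x| by rewrite -mulr2n normrMn mulr_natl.
rewrite !norm4 !normDD => TSt TSi TSj.
have := lerB_normD (delta i (f - g)) (delta j (f - g)).
have := lerB_normD (delta j (f + g)) (delta i (f + g)).
rewrite [delta j (f + g) + _]addrC.
move: (normr_ge0 (delta i (f - g))) (normr_ge0 (delta j (f + g))).
by case: TSi; case: TSj; case: TSt; lra.
Qed.
End StablePhaseRetrieval.

(** * Increments of continuous functions on [1, w^n] *)

Section OrdinalFunctions.
Context {R : realType} {n : nat}.
Implicit Types f g : continuousType (ordinal_space n) R.

Definition node_values f (s : seq nat) : R := f (node_point n s).

Lemma node_values_cts f : tree_cts (node_values f).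
Proof.
move=> s e e0; have := @cts_fun _ _ f (node_point n s).
move/cvgrPdist_le => /(_ e e0) /node_point_nbhs [N HN].
by exists N => c t /HN; rewrite /node_values distrC.
Qed.

Lemma node_values_take f s : node_values f s = node_values f (take n s).
Proof.
rewrite /node_values; congr (f _); do 2 apply: val_inj; rewrite /=.
by elim: n 0%N s => [//|m IH] a [|c s] //=; rewrite -IH.
Qed.

Lemma tree_diff_norming f D x :
  (forall s, `|tree_diff (node_values f) s| <= D) -> `|f x| <= n.+1%:R * D.
Proof.
move=> fD; have [s ->] := node_point_surj x.
have := tree_diff_bound (take n s) fD.
rewrite -node_values_take => /le_trans; apply; apply: ler_wpM2r.
  exact: le_trans (normr_ge0 _) (fD [::]).
by rewrite ler_nat ltnS size_take; case: ltnP.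
Qed.

(** Only finitely many increments exceed 1, so the increments are bounded and hence so is [f]. *)
Lemma ordinal_fun_bounded f : exists M, forall x, `|f x| <= M.
Proof.
have [L HL] := tree_diff_small (@node_values_cts f) (node_values_take f) ltr01.
pose a := tree_diff (node_values f).
exists (n.+1%:R * (1 + \sum_(s <- L) `|a s|)) => x; apply: tree_diff_norming => s.
have [sL|/HL h] := boolP (s \in L); last first.
  by rewrite (le_trans h) // lerDl sumr_ge0.
rewrite (big_rem s sL) /= -/(a s) addrCA lerDl addr_ge0 //.
by rewrite sumr_ge0.
Qed.

Lemma tree_diff_linear k f g s :
  tree_diff (node_values (k *: f + g)) s =
    k * tree_diff (node_values f) s + tree_diff (node_values g) s.
Proof.
by case: s => [|c s] //=; rewrite /node_values ctsD ctsZ ctsD ctsZ; ring.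
Qed.

Definition pair_values f : seq nat -> R :=
  pair_tree (tree_diff_seq (node_values f)).

Lemma pair_values_linear k f g s :
  pair_values (k *: f + g) s = k * pair_values f s + pair_values g s.
Proof.
have dl j : tree_diff_seq (node_values (k *: f + g)) j =
    k * tree_diff_seq (node_values f) j + tree_diff_seq (node_values g) j.
  rewrite /tree_diff_seq; case: pickle_inv => [t|]; first exact: tree_diff_linear.
  by rewrite mulr0 addr0.
by case: s => [|j [|i s]]; rewrite /pair_values /= ?dl; ring.
Qed.

Lemma pair_values_cts f : tree_cts (pair_values f).
Proof.
exact/pair_tree_cts/(tree_diff_seq_null (@node_values_cts f) (node_values_take f)).
Qed.

(** Each increment is at most 2M, which is why the sums of two are divided by 4. *)
Lemma pair_values_bound f M s : (forall x, `|f x| <= M) -> `|pair_values f s| <= M.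
Proof.
move=> fM; have M0 : 0 <= M := le_trans (normr_ge0 _) (fM (node_point n [::])).
have dM k : `|tree_diff_seq (node_values f) k| <= M + M.
  rewrite /tree_diff_seq; case: pickle_inv => [[|c t]|] /=.
  - by rewrite (le_trans (fM _)) // lerDl.
  - by rewrite (le_trans (ler_normB _ _)) // lerD // fM.
  - by rewrite normr0 addr_ge0.
rewrite /pair_values; case: s => [|j [|i s]] /=; first by rewrite normr0.
  by have := dM j; rewrite !ler_norml; lra.
by have := dM j; have := dM (j + i)%N; rewrite !ler_norml; lra.
Qed.

Lemma pair_values_pickle f s t : (pickle s <= pickle t)%N ->
  pair_values f [:: pickle s; (pickle t - pickle s)%N] =
    (tree_diff (node_values f) s + tree_diff (node_values f) t) / 4.
Proof.
by move=> st; rewrite /pair_values /= subnKC // !tree_diff_seq_pickle.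
Qed.

End OrdinalFunctions.

(** * Assembly of the embedding *)

Lemma cantor_bendixson_decr {K : topologicalType} j k :
  (j <= k)%N -> @cantor_bendixson K k `<=` cantor_bendixson j.
Proof.
move=> /subnK <-; elim: (k - j)%N => [//|i IH].
by rewrite addSn => x [/IH].
Qed.

Theorem theorem4p5 (R : realType) (K : topologicalType)
    (cptK : compact [set: K]) (hausK : hausdorff_space K)
    (alpha : nat) (alpha_ge3 : (3 <= alpha)%N)
    (K_alpha : @cantor_bendixson K alpha !=set0) :
  exists T : {linear continuousType (ordinal_space alpha) R ->
                     continuousType K R},
    (forall f, supnorm (T f) = supnorm f) /\ does_SPR (range T).
Proof.
case: K_alpha => p Kp.
(* As alpha is at least 3, [p] is a limit of points of the second derived set; one of them will be
   the root of the height 2 tree. *)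
have K3p : derived_set (@cantor_bendixson K 2) p :=
  cantor_bendixson_decr alpha_ge3 Kp.
have [q [V [Kq oV Vq _ [Vp _]]]] := derived_set_seq hausK K3p (@openT K) I.
have qp : q 0%N <> p by move=> qp; apply: (Vp 0%N); rewrite -qp.
have := hausK; rewrite open_hausdorff => /(_ (q 0%N) p ltac:(exact/eqP)).
case=> -[U2 U1] /= [/set_mem U2q /set_mem U1p] [oU2 oU1 /eqP U21].
have disj t : U1 t -> ~ U2 t.
  by move=> t1 t2; have [] : (set0 : set K) t by rewrite -U21.
have [Phi1 [r1 B1]] := bump_tree_exists (R := R) cptK hausK Kp oU1 U1p.
have [Phi2 [r2 B2]] := bump_tree_exists (R := R) cptK hausK (Kq 0%N) oU2 U2q.
pose F (f : continuousType (ordinal_space alpha) R) t :=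
  Phi1 (node_values f) t + Phi2 (pair_values f) t.
have Fcts f : continuous (F f).
  move=> t; apply: cvgD; first exact/(bump_tree_cts B1)/node_values_cts.
  exact/(bump_tree_cts B2)/pair_values_cts.
pose T0 f : continuousType K R := mkcts (Fcts f).
have T0lin : linear T0.
  move=> k f g; apply/continuousEP => t.
  rewrite ctsD ctsZ /= /mkcts /F.
  have -> : pair_values (k *: f + g) =
      fun s => k * pair_values f s + pair_values g s.
    exact/funext/pair_values_linear.
  by rewrite (bump_tree_linear B1) (bump_tree_linear B2); ring.
pose T : {linear continuousType (ordinal_space alpha) R -> continuousType K R} :=
  HB.pack T0 (GRing.isLinear.Build _ _ _ _ T0 T0lin).
have T1 f s : (size s <= alpha)%N -> T f (r1 s) = node_values f s.
  move=> sa; rewrite /= /mkcts /F (bump_tree_eval B1) //.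
  by rewrite (bump_tree_support B2) ?addr0 //; exact/disj/(bump_tree_point B1).
have T2 f s : (size s <= 2)%N -> T f (r2 s) = pair_values f s.
  move=> s2; rewrite /= /mkcts /F (bump_tree_eval B2) //
    (bump_tree_support B1) ?add0r //.
  by move=> U1r; exact: disj U1r (bump_tree_point B2 s2).
have TM (f : continuousType (ordinal_space alpha) R) M t :
    (forall x, `|f x| <= M) -> `|T f t| <= M.
  move=> fM; have M0 : 0 <= M := le_trans (normr_ge0 _) (fM (node_point alpha [::])).
  rewrite /= /mkcts /F ler_norml.
  have [U1t|nU1] := pselect (U1 t).
    rewrite (bump_tree_support B2) ?addr0; last exact: disj.
    apply: (bump_tree_range B1); [lra|lra|move=> s].
    by rewrite -ler_norml; exact: fM.
  rewrite (bump_tree_support B1) // add0r.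
  apply: (bump_tree_range B2); [lra|lra|move=> s].
  by rewrite -ler_norml; exact: pair_values_bound.
have Tbnd f : exists M, forall t, `|T f t| <= M.
  by have [M fM] := ordinal_fun_bounded f; exists M => t; exact: TM.
have Tisom f : supnorm (T f) = supnorm f.
  have [M fM] := ordinal_fun_bounded f.
  apply/eqP; rewrite eq_le; apply/andP; split.
    by apply: (supnorm_le p) => t; apply: TM => x; exact: (supnorm_ub (M := M)).
  apply: (supnorm_le (node_point alpha [::])) => x.
  have [s ->] := node_point_surj x.
  rewrite -/(node_values f s) node_values_take -T1 ?size_take; last first.
    by case: ltnP => // /ltnW.
  by apply: (supnorm_ub (M := M)) => t; exact: TM.
exists T; split=> //; exists (8 * alpha.+1%:R).
  by rewrite -natrM ler1n.
apply: (pair_functionals_CSPR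
  (delta := fun s f => tree_diff (node_values f) s)) => //.
- move=> f D fD; apply: (supnorm_le (node_point alpha [::])) => x.
  exact: tree_diff_norming.
(* [pair_tree] codes a pair with the smaller index first; the sum is symmetric. *)
- move=> s t; case: (leqP (pickle s) (pickle t)) => [st|/ltnW ts].
    exists (r2 [:: pickle s; (pickle t - pickle s)%N]) => f.
    by rewrite T2 // pair_values_pickle.
  exists (r2 [:: pickle t; (pickle s - pickle t)%N]) => f.
  by rewrite T2 // pair_values_pickle // addrC.
Qed.
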